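(* Let $E$ be a row-finite graph, let $R$ be a commutative ring with unit $1\neq 0$, and let $L_R(E)$ be the associated Leavitt path algebra. Then the following are equivalent. (1) $L_R(E)$ is basically simple. (2) $E$ satisfies Condition (L), and the only saturated hereditary subsets of $E^0$ are $\emptyset$ and $E^0$. (3) $E$ satisfies Condition (K), and the only saturated hereditary subsets of $E^0$ are $\emptyset$ and $E^0$. (4) $E$ satisfies Condition (L), $E$ is cofinal, and whenever $v$ is a sink in $E$ and $w \in E^0$ there is a path from $w$ to $v$. (5) $E$ satisfies Condition (K), $E$ is cofinal, and whenever $v$ is a sink in $E$ and $w \in E^0$ there is a path from $w$ to $v$.
   Context: Graphs: a graph is a directed graph $E=(E^0,E^1,r,s)$ with countable sets $E^0$ (vertices), $E^1$ (edges) and maps $r,s:E^1\to E^0$ (range, source). It is row-finite if $s^{-1}(v)$ is finite for every $v\in E^0$. A sink is a vertex $v$ with $s^{-1}(v)=\emptyset$. A vertex $v$ is regular, $v\in E^0_{\mathrm{reg}}$, if $0<|s^{-1}(v)|<\infty$. A path of length $n\ge 1$ is $\alpha=e_1\cdots e_n$ with $e_i\in E^1$ and $r(e_i)=s(e_{i+1})$; put $s(\alpha)=s(e_1)$, $r(\alpha)=r(e_n)$. Vertices are paths of length $0$ (with $r(v)=s(v)=v$). $E^*$ is the set of all finite paths. A path from $w$ to $v$ is an $\alpha\in E^*$ with $s(\alpha)=w$, $r(\alpha)=v$. A cycle (or closed path) is a path $\alpha\in E^*\setminus E^0$ with $s(\alpha)=r(\alpha)$; this vertex is its base. An exit for $\alpha=e_1\cdots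 e_n$ is an edge $f\in E^1$ such that, for some $1\le i\le n$, $s(f)=s(e_i)$ but $f\ne e_i$. $E$ satisfies Condition (L) if every cycle in $E$ has an exit. A closed path $e_1\cdots e_n$ is simple if $s(e_i)\neq s(e_1)$ for $i=2,\dots,n$. $E$ satisfies Condition (K) if every vertex is either the base of no closed path or the base of at least two simple closed paths. $E$ is cofinal if whenever $e_1e_2e_3\ldots$ is an infinite path in $E$ (edges with $r(e_i)=s(e_{i+1})$ for all $i$) and $v\in E^0$, there exists a finite path from $v$ to $s(e_i)$ for some $i\in\mathbb{N}$. A subset $H\subseteq E^0$ is hereditary if $e\in E^1$ and $s(e)\in H$ imply $r(e)\in H$. A hereditary $H$ is saturated if $v\in E^0_{\mathrm{reg}}$ and $r(s^{-1}(v))\subseteq H$ imply $v\in H$. Rings are not assumed commutative or unital. For $R$ a commutative ring with unit $1$, an $R$-algebra is a ring $A$ that is also a left $R$-module with $\lambda(xy)=(\lambda x)y=x(\lambda y)$ and $1\cdot x=x$; homomorphisms of $R$-algebras are $R$-linear ring homomorphisms. A Leavitt $E$-family in a ring is a collection $\{v,e,e^*:v\in E^0,e\in E^1\}$ of elements such that the $v$'s are pairwise orthogonal idempotents and: (1) $s(e)e=er(e)=e$; (2) $r(e)e^*=e^*s(e)=e^*$; (3) $e^*f=\delta_{e,f}\,r(e)$ for all $e,f\in E^1$; (4) $v=\sum_{s(e)=v}ee^*$ for every $v\in E^0_{\mathrm{reg}}$. The Leavitt path algebra $L_R(E)$ is the universal $R$-algebra generated by a Leavitt $E$-family $\{v,e,e^*\}$: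 every Leavitt $E$-family $\{a_v,b_e,c_{e^*}\}$ in an $R$-algebra $A$ is the image of the generators under an $R$-algebra homomorphism $L_R(E)\to A$ with $v\mapsto a_v$, $e\mapsto b_e$, $e^*\mapsto c_{e^*}$. A two-sided ideal $I$ of $L_R(E)$ is basic if whenever $\lambda\in R\setminus\{0\}$, $v\in E^0$ and $\lambda v\in I$, then $v\in I$. $L_R(E)$ is basically simple if its only basic ideals are $\{0\}$ and $L_R(E)$. *)

(* Defs.v *)
From HB Require Import structures.
From mathcomp Require Import all_boot all_algebra generic_quotient.
From mathcomp Require Import boolp classical_sets functions cardinality fsbigop.

Set Implicit Arguments.
Unset Strict Implicit.
Unset Printing Implicit Defensive.

Import GRing.Theory.

Local Open Scope classical_set_scope.
Local Open Scope quotient_scope.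
Local Open Scope ring_scope.

Record graph := Graph {
  vertex : countType;
  edge : countType;
  rg : edge -> vertex;
  src : edge -> vertex
}.

Definition out_edges (E : graph) (v : vertex E) : set (edge E) :=
  [set e | src e = v].

Definition row_finite (E : graph) := forall v : vertex E, finite_set (out_edges v).

Definition sink (E : graph) (v : vertex E) := out_edges v = set0.

Definition regular (E : graph) (v : vertex E) :=
  out_edges v !=set0 /\ finite_set (out_edges v).

(* [gpath w v p]: the edges of [p] form a path from [w] to [v]; the empty
   sequence stands for the path of length 0 at [w = v]. *)
Fixpoint gpath (E : graph) (w v : vertex E) (p : seq (edge E)) : Prop :=
  if p is e :: p' then src e = w /\ gpath (rg e) v p' else w = v.

Definition closed_path (E : graph) (v : vertex E) (p : seq (edge E)) :=
  p <> [::] /\ gpath v v p.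

Definition simple_closed_path (E : graph) (v : vertex E) (p : seq (edge E)) :=
  closed_path v p /\ forall e, e \in behead p -> src e <> v.

Definition is_exit (E : graph) (p : seq (edge E)) (f : edge E) :=
  exists e, [/\ e \in p, src f = src e & f <> e].

Definition condition_L (E : graph) :=
  forall (v : vertex E) p, closed_path v p -> exists f, is_exit p f.

Definition condition_K (E : graph) :=
  forall v : vertex E,
    (forall p, ~ closed_path v p) \/
    (exists p q, [/\ p <> q, simple_closed_path v p & simple_closed_path v q]).

Definition infinite_path (E : graph) (x : nat -> edge E) :=
  forall i, rg (x i) = src (x i.+1).

Definition cofinal (E : graph) :=
  forall (x : nat -> edge E) (v : vertex E), infinite_path x ->
    exists i p, gpath v (src (x i)) p.

Definition sinks_reachable (E : graph) :=
  forall v w : vertex E, sink v -> exists p, gpath w v p.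

Definition hereditary (E : graph) (H : set (vertex E)) :=
  forall e, H (src e) -> H (rg e).

Definition saturated (E : graph) (H : set (vertex E)) :=
  forall v, regular v -> @rg E @` out_edges v `<=` H -> H v.

Definition only_trivial_saturated_hereditary (E : graph) :=
  forall H : set (vertex E), hereditary H -> saturated H -> H = set0 \/ H = setT.

(* [nualgType R]: R-algebras, not necessarily unital or commutative *)
Reserved Notation "x ** y" (at level 40, left associativity).

HB.mixin Record Lmodule_isNUAlgebra (R : comNzRingType) V
    of GRing.Lmodule R V := {
  numul : V -> V -> V;
  numulA : associative numul;
  numulDl : left_distributive numul +%R;
  numulDr : right_distributive numul +%R;
  nuscalerAl : forall (c : R) x y, c *: numul x y = numul (c *: x) y;
  nuscalerAr : forall (c : R) x y, c *: numul x y = numul x (c *: y)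
}.

#[short(type="nualgType")]
HB.structure Definition NUAlgebra (R : comNzRingType) :=
  {V of GRing.Lmodule R V & Lmodule_isNUAlgebra R V}.

Notation "x ** y" := (numul x y) : ring_scope.

Definition nualg_hom (R : comNzRingType) (A B : nualgType R) (f : A -> B) :=
  [/\ forall x y, f (x + y) = f x + f y,
      forall (c : R) x, f (c *: x) = c *: f x
    & forall x y, f (x ** y) = f x ** f y].

Definition subalgebra (R : comNzRingType) (A : nualgType R) (S : set A) :=
  [/\ S 0, forall x y, S x -> S y -> S (x + y),
      forall (c : R) x, S x -> S (c *: x)
    & forall x y, S x -> S y -> S (x ** y)].

(* Two-sided ideals are ideals of the underlying ring: closure under scalars
   is not assumed. *)
Definition ideal (R : comNzRingType) (A : nualgType R) (I : set A) :=
  [/\ I 0, forall x y, I x -> I y -> I (x - y),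
      forall a x, I x -> I (a ** x)
    & forall a x, I x -> I (x ** a)].

Record leavitt_family (R : comNzRingType) (E : graph) (A : nualgType R)
    (a : vertex E -> A) (b c : edge E -> A) : Prop := LeavittFamily {
  lf_orth : forall v w, a v ** a w = if v == w then a v else 0;
  lf_srcl : forall e, a (src e) ** b e = b e;
  lf_rgr : forall e, b e ** a (rg e) = b e;
  lf_rgl : forall e, a (rg e) ** c e = c e;
  lf_srcr : forall e, c e ** a (src e) = c e;
  lf_ghost : forall e f, c e ** b f = if e == f then a (rg e) else 0;
  lf_sum : forall v, regular v -> a v = \sum_(e \in out_edges v) (b e ** c e)
}.

(* A universal R-algebra generated by a Leavitt E-family; it is determined up
   to isomorphism, and [leavitt_exists] below shows that there is one. *)
Record leavittPathAlgebra (R : comNzRingType) (E : graph) := LeavittPathAlgebra {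
  lpa_alg :> nualgType R;
  lpa_vertex : vertex E -> lpa_alg;
  lpa_edge : edge E -> lpa_alg;
  lpa_ghost : edge E -> lpa_alg;
  lpa_family : leavitt_family lpa_vertex lpa_edge lpa_ghost;
  lpa_generated : forall S : set lpa_alg, subalgebra S ->
    (forall v, S (lpa_vertex v)) -> (forall e, S (lpa_edge e)) ->
    (forall e, S (lpa_ghost e)) -> S = setT;
  lpa_universal : forall (A : nualgType R)
      (a : vertex E -> A) (b c : edge E -> A), leavitt_family a b c ->
    exists f : lpa_alg -> A,
      [/\ nualg_hom f, forall v, f (lpa_vertex v) = a v,
          forall e, f (lpa_edge e) = b e & forall e, f (lpa_ghost e) = c e]
}.

Definition basic_ideal (R : comNzRingType) (E : graph)
    (L : leavittPathAlgebra R E) (I : set L) :=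
  ideal I /\
  forall (c : R) (v : vertex E), c != 0 ->
    I (c *: lpa_vertex L v) -> I (lpa_vertex L v).

Definition basically_simple (R : comNzRingType) (E : graph)
    (L : leavittPathAlgebra R E) :=
  forall I : set L, basic_ideal I -> I = [set 0] \/ I = setT.

(* Existence: terms modulo the least congruence imposing the algebra axioms and
   the Leavitt relations. *)
Inductive lterm (R : comNzRingType) (E : graph) : Type :=
| LVertex of vertex E
| LEdge of edge E
| LGhost of edge E
| LZero
| LAdd of lterm R E & lterm R E
| LOpp of lterm R E
| LScale of R & lterm R E
| LMul of lterm R E & lterm R E.

Arguments LVertex {R E}.
Arguments LEdge {R E}.
Arguments LGhost {R E}.
Arguments LZero {R E}.

HB.instance Definition _ (R : comNzRingType) (E : graph) :=
  gen_eqMixin (lterm R E).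
HB.instance Definition _ (R : comNzRingType) (E : graph) :=
  gen_choiceMixin (lterm R E).

Definition lsum (R : comNzRingType) (E : graph) (s : seq (edge E)) : lterm R E :=
  foldr (fun e t => LAdd (LMul (LEdge e) (LGhost e)) t) LZero s.

Inductive lcong (R : comNzRingType) (E : graph) : lterm R E -> lterm R E -> Prop :=
| lc_refl t : lcong t t
| lc_sym t u : lcong t u -> lcong u t
| lc_trans t u w : lcong t u -> lcong u w -> lcong t w
| lc_add t t' u u' : lcong t t' -> lcong u u' -> lcong (LAdd t u) (LAdd t' u')
| lc_opp t t' : lcong t t' -> lcong (LOpp t) (LOpp t')
| lc_scale c t t' : lcong t t' -> lcong (LScale c t) (LScale c t')
| lc_mul t t' u u' : lcong t t' -> lcong u u' -> lcong (LMul t u) (LMul t' u')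
| lc_addA t u w : lcong (LAdd t (LAdd u w)) (LAdd (LAdd t u) w)
| lc_addC t u : lcong (LAdd t u) (LAdd u t)
| lc_add0 t : lcong (LAdd LZero t) t
| lc_addN t : lcong (LAdd (LOpp t) t) LZero
| lc_scaleA c d t : lcong (LScale c (LScale d t)) (LScale (c * d) t)
| lc_scale1 t : lcong (LScale 1 t) t
| lc_scaleDr c t u : lcong (LScale c (LAdd t u)) (LAdd (LScale c t) (LScale c u))
| lc_scaleDl c d t : lcong (LScale (c + d) t) (LAdd (LScale c t) (LScale d t))
| lc_mulA t u w : lcong (LMul t (LMul u w)) (LMul (LMul t u) w)
| lc_mulDl t u w : lcong (LMul (LAdd t u) w) (LAdd (LMul t w) (LMul u w))
| lc_mulDr t u w : lcong (LMul t (LAdd u w)) (LAdd (LMul t u) (LMul t w))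
| lc_scaleAl c t u : lcong (LScale c (LMul t u)) (LMul (LScale c t) u)
| lc_scaleAr c t u : lcong (LScale c (LMul t u)) (LMul t (LScale c u))
| lc_orth v w : lcong (LMul (LVertex v) (LVertex w))
                      (if v == w then LVertex v else LZero)
| lc_srcl e : lcong (LMul (LVertex (src e)) (LEdge e)) (LEdge e)
| lc_rgr e : lcong (LMul (LEdge e) (LVertex (rg e))) (LEdge e)
| lc_rgl e : lcong (LMul (LVertex (rg e)) (LGhost e)) (LGhost e)
| lc_srcr e : lcong (LMul (LGhost e) (LVertex (src e))) (LGhost e)
| lc_ghost e f : lcong (LMul (LGhost e) (LEdge f))
                       (if e == f then LVertex (rg e) else LZero)
| lc_sum v : regular v ->
    lcong (LVertex v) (lsum R (finmap.enum_fset (fset_set (out_edges v)))).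

Definition lrel (R : comNzRingType) (E : graph) : rel (lterm R E) :=
  fun t u => `[< lcong t u >].

Lemma lrel_refl (R : comNzRingType) (E : graph) : reflexive (@lrel R E).
Proof. by move=> t; apply/asboolP; exact: lc_refl. Qed.

Lemma lrel_sym (R : comNzRingType) (E : graph) : symmetric (@lrel R E).
Proof. by move=> t u; apply/asboolP/asboolP; exact: lc_sym. Qed.

Lemma lrel_trans (R : comNzRingType) (E : graph) : transitive (@lrel R E).
Proof.
by move=> u t w /asboolP tu /asboolP uw; apply/asboolP; exact: lc_trans tu uw.
Qed.

Canonical lrel_equiv (R : comNzRingType) (E : graph) :=
  EquivRel (@lrel R E) (@lrel_refl R E) (@lrel_sym R E) (@lrel_trans R E).

Definition lquot (R : comNzRingType) (E : graph) := {eq_quot (@lrel R E)}.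

HB.instance Definition _ (R : comNzRingType) (E : graph) :=
  Choice.on (lquot R E).

Definition lpi (R : comNzRingType) (E : graph) (t : lterm R E) : lquot R E :=
  \pi_(lquot R E) t.
Definition lrepr (R : comNzRingType) (E : graph) (x : lquot R E) : lterm R E :=
  repr x.

Lemma lpiP (R : comNzRingType) (E : graph) (t u : lterm R E) :
  lcong t u -> lpi t = lpi u.
Proof. by move=> tu; apply/(@eqmodP _ (lrel_equiv R E))/asboolP. Qed.

Lemma lreprK (R : comNzRingType) (E : graph) (x : lquot R E) : lpi (lrepr x) = x.
Proof. exact: reprK. Qed.

Lemma lrepr_pi (R : comNzRingType) (E : graph) (t : lterm R E) :
  lcong (lrepr (lpi t)) t.
Proof.
by apply: (asboolW _); apply/(@eqmodP _ (lrel_equiv R E)); exact: lreprK.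
Qed.

Definition ladd (R : comNzRingType) (E : graph) (x y : lquot R E) :=
  lpi (LAdd (lrepr x) (lrepr y)).
Definition lopp (R : comNzRingType) (E : graph) (x : lquot R E) :=
  lpi (LOpp (lrepr x)).
Definition lscale (R : comNzRingType) (E : graph) (c : R) (x : lquot R E) :=
  lpi (LScale c (lrepr x)).
Definition lmul (R : comNzRingType) (E : graph) (x y : lquot R E) :=
  lpi (LMul (lrepr x) (lrepr y)).

Lemma lpi_add (R : comNzRingType) (E : graph) (t u : lterm R E) :
  ladd (lpi t) (lpi u) = lpi (LAdd t u).
Proof. by apply: lpiP; apply: lc_add; exact: lrepr_pi. Qed.

Lemma lpi_opp (R : comNzRingType) (E : graph) (t : lterm R E) :
  lopp (lpi t) = lpi (LOpp t).
Proof. by apply: lpiP; apply: lc_opp; exact: lrepr_pi. Qed.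

Lemma lpi_scale (R : comNzRingType) (E : graph) (c : R) (t : lterm R E) :
  lscale c (lpi t) = lpi (LScale c t).
Proof. by apply: lpiP; apply: lc_scale; exact: lrepr_pi. Qed.

Lemma lpi_mul (R : comNzRingType) (E : graph) (t u : lterm R E) :
  lmul (lpi t) (lpi u) = lpi (LMul t u).
Proof. by apply: lpiP; apply: lc_mul; exact: lrepr_pi. Qed.

Lemma laddA (R : comNzRingType) (E : graph) : associative (@ladd R E).
Proof.
move=> x y z; rewrite -[x]lreprK -[y]lreprK -[z]lreprK !lpi_add.
by apply: lpiP; exact: lc_addA.
Qed.

Lemma laddC (R : comNzRingType) (E : graph) : commutative (@ladd R E).
Proof. by move=> x y; apply: lpiP; exact: lc_addC. Qed.

Lemma ladd0 (R : comNzRingType) (E : graph) : left_id (lpi LZero) (@ladd R E).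
Proof. by move=> x; rewrite -[x]lreprK lpi_add; apply: lpiP; exact: lc_add0. Qed.

Lemma laddN (R : comNzRingType) (E : graph) :
  left_inverse (lpi LZero) (@lopp R E) (@ladd R E).
Proof.
by move=> x; rewrite -[x]lreprK lpi_opp lpi_add; apply: lpiP; exact: lc_addN.
Qed.

HB.instance Definition _ (R : comNzRingType) (E : graph) :=
  GRing.isZmodule.Build (lquot R E)
    (@laddA R E) (@laddC R E) (@ladd0 R E) (@laddN R E).

Lemma lscaleA (R : comNzRingType) (E : graph) (c d : R) (x : lquot R E) :
  lscale c (lscale d x) = lscale (c * d) x.
Proof. by rewrite -[x]lreprK !lpi_scale; apply: lpiP; exact: lc_scaleA. Qed.

Lemma lscale1 (R : comNzRingType) (E : graph) : left_id 1 (@lscale R E).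
Proof. by move=> x; rewrite -[x]lreprK lpi_scale; apply: lpiP; exact: lc_scale1. Qed.

Lemma lscaleDr (R : comNzRingType) (E : graph) :
  right_distributive (@lscale R E) +%R.
Proof.
move=> c x y; rewrite -[x]lreprK -[y]lreprK [_ + _]lpi_add !lpi_scale.
by rewrite [RHS]lpi_add; apply: lpiP; exact: lc_scaleDr.
Qed.

Lemma lscaleDl (R : comNzRingType) (E : graph) (x : lquot R E) :
  {morph (@lscale R E)^~ x : c d / c + d}.
Proof.
move=> c d; rewrite -[x]lreprK !lpi_scale [RHS]lpi_add.
by apply: lpiP; exact: lc_scaleDl.
Qed.

HB.instance Definition _ (R : comNzRingType) (E : graph) :=
  GRing.Zmodule_isLmodule.Build R (lquot R E)
    (@lscaleA R E) (@lscale1 R E) (@lscaleDr R E) (@lscaleDl R E).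

Lemma lmulA (R : comNzRingType) (E : graph) : associative (@lmul R E).
Proof.
move=> x y z; rewrite -[x]lreprK -[y]lreprK -[z]lreprK !lpi_mul.
by apply: lpiP; exact: lc_mulA.
Qed.

Lemma lmulDl (R : comNzRingType) (E : graph) : left_distributive (@lmul R E) +%R.
Proof.
move=> x y z; rewrite -[x]lreprK -[y]lreprK -[z]lreprK [_ + _]lpi_add !lpi_mul.
by rewrite [RHS]lpi_add; apply: lpiP; exact: lc_mulDl.
Qed.

Lemma lmulDr (R : comNzRingType) (E : graph) : right_distributive (@lmul R E) +%R.
Proof.
move=> x y z; rewrite -[x]lreprK -[y]lreprK -[z]lreprK [_ + _]lpi_add !lpi_mul.
by rewrite [RHS]lpi_add; apply: lpiP; exact: lc_mulDr.
Qed.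

Lemma lscaleAl (R : comNzRingType) (E : graph) (c : R) (x y : lquot R E) :
  c *: lmul x y = lmul (c *: x) y.
Proof.
rewrite -[x]lreprK -[y]lreprK [_ *: lpi (lrepr x)]lpi_scale !lpi_mul.
by rewrite [LHS]lpi_scale; apply: lpiP; exact: lc_scaleAl.
Qed.

Lemma lscaleAr (R : comNzRingType) (E : graph) (c : R) (x y : lquot R E) :
  c *: lmul x y = lmul x (c *: y).
Proof.
rewrite -[x]lreprK -[y]lreprK [_ *: lpi (lrepr y)]lpi_scale !lpi_mul.
by rewrite [LHS]lpi_scale; apply: lpiP; exact: lc_scaleAr.
Qed.

HB.instance Definition _ (R : comNzRingType) (E : graph) :=
  Lmodule_isNUAlgebra.Build R (lquot R E)
    (@lmulA R E) (@lmulDl R E) (@lmulDr R E) (@lscaleAl R E) (@lscaleAr R E).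

Lemma lpi_lsum (R : comNzRingType) (E : graph) (s : seq (edge E)) :
  lpi (lsum R s) = \sum_(e <- s) (lpi (LEdge e) ** lpi (LGhost e)).
Proof.
elim: s => [|e s IHs]; first by rewrite big_nil.
by rewrite big_cons -IHs [_ ** _]lpi_mul [RHS]lpi_add.
Qed.

Lemma lquot_family (R : comNzRingType) (E : graph) :
  @leavitt_family R E (lquot R E) (fun v => lpi (LVertex v))
    (fun e => lpi (LEdge e)) (fun e => lpi (LGhost e)).
Proof.
split=> [v w|e|e|e|e|e f|v v_reg]; try rewrite [_ ** _]lpi_mul.
- by rewrite (lpiP (lc_orth _ _ _)); case: ifP.
- exact/lpiP/lc_srcl.
- exact/lpiP/lc_rgr.
- exact/lpiP/lc_rgl.
- exact/lpiP/lc_srcr.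
- by rewrite (lpiP (lc_ghost _ _ _)); case: ifP.
- by rewrite (lpiP (lc_sum _ v_reg)) lpi_lsum fsbig_finite //; case: v_reg.
Qed.

Fixpoint leval (R : comNzRingType) (E : graph) (A : nualgType R)
    (a : vertex E -> A) (b c : edge E -> A) (t : lterm R E) : A :=
  match t with
  | LVertex v => a v
  | LEdge e => b e
  | LGhost e => c e
  | LZero => 0
  | LAdd t u => leval a b c t + leval a b c u
  | LOpp t => - leval a b c t
  | LScale k t => k *: leval a b c t
  | LMul t u => leval a b c t ** leval a b c u
  end.

Lemma leval_cong (R : comNzRingType) (E : graph) (A : nualgType R)
    (a : vertex E -> A) (b c : edge E -> A) (t u : lterm R E) :
  leavitt_family a b c -> lcong t u -> leval a b c t = leval a b c u.
Proof.
case=> orth srcl rgr rgl srcr ghost vsum.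
elim=> {t u} /=; try by move=> *; congruence.
- by move=> *; rewrite addrA.
- by move=> *; rewrite addrC.
- by move=> *; rewrite add0r.
- by move=> *; rewrite addNr.
- by move=> *; rewrite scalerA.
- by move=> *; rewrite scale1r.
- by move=> *; rewrite scalerDr.
- by move=> *; rewrite scalerDl.
- by move=> *; rewrite numulA.
- by move=> *; rewrite numulDl.
- by move=> *; rewrite numulDr.
- by move=> *; rewrite nuscalerAl.
- by move=> *; rewrite nuscalerAr.
- by move=> v w; rewrite orth; case: ifP.
- by move=> e f; rewrite ghost; case: ifP.
move=> v v_reg; rewrite vsum // fsbig_finite /=; last by case: v_reg.
elim: (finmap.enum_fset _) => [|e s IHs] /=; first by rewrite big_nil.
by rewrite big_cons IHs.
Qed.

Lemma leavitt_exists (R : comNzRingType) (E : graph) :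
  inhabited (leavittPathAlgebra R E).
Proof.
split; apply: (@LeavittPathAlgebra R E (lquot R E) (fun v => lpi (LVertex v))
  (fun e => lpi (LEdge e)) (fun e => lpi (LGhost e))).
- exact: lquot_family.
- move=> S [S0 SD SZ SM] Sv Se Sg.
  suff St t : S (lpi t).
    by rewrite -subTset => x _; rewrite -[x]lreprK; exact: St.
  elim: t => //= [t St u Su|t St|k t St|t St u Su].
  + by rewrite -lpi_add; exact: SD.
  + rewrite -lpi_opp (_ : lopp _ = (-1 : R) *: lpi t); first exact: SZ.
    by rewrite scaleN1r.
  + by rewrite -lpi_scale; exact: SZ.
  + by rewrite -lpi_mul; exact: SM.
- move=> A a b c abc.
  have evK t : leval a b c (lrepr (lpi t)) = leval a b c t.
    by apply: leval_cong => //; exact: lrepr_pi.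
  exists (fun x => leval a b c (lrepr x)).
  by split; [split=> * | ..]; try move=> ?; rewrite evK.
Qed.

(* Main.v *)
From HB Require Import structures.
Require Import Defs.
From mathcomp Require Import all_boot all_algebra.
From mathcomp Require Import boolp classical_sets functions cardinality fsbigop.

Set Implicit Arguments.
Unset Strict Implicit.
Unset Printing Implicit Defensive.

Import GRing.Theory.

Local Open Scope classical_set_scope.
Local Open Scope ring_scope.

(** Two groups of arguments give the theorem.

    On the side of graphs, the vertices that do not reach an infinite path, or
    that do not reach a sink, form a saturated hereditary set; conversely, from
    a vertex outside a proper saturated hereditary set one walks outside this
    set, either forever or up to a sink. Hence the saturated hereditary sets are
    trivial if and only if the graph is cofinal and all vertices reach all sinks
    ([trivial_cofinal], [trivial_sinks_reachable], [cofinal_trivial]). Condition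
    (K) implies (L) because a closed path without exits can only be followed in
    one way ([condition_K_L]); under cofinality (L) implies (K) because an exit
    of a simple closed path leads back to its base and so gives a second one
    ([condition_L_K]).

    On the side of algebras, let [I] be a basic ideal that contains [x <> 0].
    The vertices in [I] form a saturated hereditary set, so it is enough to find
    a vertex in [I], and since [I] is basic a multiple [r v] with [r != 0] will
    do. As a nonsink [v] is the sum of the [e e*], some product [x e] is nonzero
    if [x v] is; iterating this removes the ghost edges from [x]
    ([nonzero_real_part]). For the same reason some [e* x] is nonzero, and these
    products shorten the paths in [x] until a nonzero multiple of a vertex
    appears, plus closed paths at it ([vertex_plus_closed_paths]). Now
    conjugation [y |-> e* y e] keeps the multiple of the vertex, rotates the
    closed paths that begin with [e] and removes the others; conjugating along a
    closed path and then by an exit removes this path, and (L) allows this to go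
    on until only the vertex is left ([remove_closed_path],
    [scaled_vertex_in_ideal]).

    For the converse, basic ideals are obtained as kernels of representations on
    functions over [vertex E * int]. Given a saturated hereditary set [H], the
    points over a regular vertex outside [H] are split into residue classes, one
    for each edge that avoids [H], and the edge identifies its class with the
    points over its range ([shift_family]). A multiple [c v] with [c != 0] is in
    the kernel exactly for [v] in [H], so the kernel is basic and simplicity
    makes [H] trivial. The residues are taken with an offset [t]: a closed path
    without exits acts as its base for [t = 0] but as a translation for [t = 1],
    so that without (L) the kernel for [t = 0] would be a nonzero proper basic
    ideal. *)

(** * Paths and closed paths *)

Section Graphs.

Variable E : graph.
Implicit Types (u v w : vertex E) (e f : edge E) (p q : seq (edge E)).

Lemma gpath_cat u v w p q : gpath u v p -> gpath v w q -> gpath u w (p ++ q).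
Proof.
elim: p u => [|e p IHp] u /=; first by move=> ->.
by move=> [-> pv] qw; split=> //; exact: IHp.
Qed.

Lemma gpath_end u v w p : gpath u v p -> gpath u w p -> v = w.
Proof.
elim: p u => [|e p IHp] u /=; first by move=> -> ->.
by move=> [_ pv] [_ pw]; exact: IHp pv pw.
Qed.

Lemma gpath_rcons u e p : gpath u (src e) p -> gpath u (rg e) (rcons p e).
Proof. by move=> pe; rewrite -cats1; exact: gpath_cat pe _. Qed.

Lemma gpath_split u v p q : gpath u v (p ++ q) ->
  exists2 w, gpath u w p & gpath w v q.
Proof.
elim: p u => [|e p IHp] u /=; first by exists u.
by move=> [<- /IHp[w pw qv]]; exists w.
Qed.

(** The path is cut at its first visit to the end point. *)
Lemma gpath_first_visit u v p : gpath u v p ->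
  exists2 q, gpath u v q & forall e, e \in q -> src e <> v.
Proof.
elim: p u => [|e p IHp] u /=; first by move=> ->; exists [::].
move=> [<- /IHp[q qv qN]].
have [<-|ev] := pselect (src e = v); first by exists [::].
by exists (e :: q) => // f; rewrite inE => /orP[/eqP->|/qN].
Qed.

Lemma closed_path_simple v p : closed_path v p ->
  exists q, simple_closed_path v q.
Proof.
case: p => [[] //|e p] [_ /= [ev pv]].
have [q qv qN] := gpath_first_visit pv.
by exists (e :: q); split=> //.
Qed.

Lemma hereditary_gpath (H : set (vertex E)) u v p :
  hereditary H -> gpath u v p -> H u -> H v.
Proof.
move=> hH; elim: p u => [|e p IHp] u /=; first by move=> ->.
by move=> [<- pv] He; apply: IHp pv _; exact: hH.
Qed.

Lemma closed_path_next v p e : closed_path v p -> e \in p ->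
  exists2 f, f \in p & src f = rg e.
Proof.
move=> [p0 pv] /splitPr ep; case: ep p0 pv => p1 p2 _ pv.
have [w p1w /= [_]] := gpath_split pv.
case: p2 pv => [|f p2] pv; last first.
  by move=> [fe _]; exists f => //; rewrite mem_cat !inE eqxx !orbT.
move=> ev; case: p1 pv {p1w} => [|f p1] /= [fv _].
  by exists e; rewrite ?inE// fv.
by exists f; rewrite ?inE ?eqxx// fv.
Qed.

Lemma closed_path_base v p : closed_path v p -> exists2 e, e \in p & src e = v.
Proof. by case: p => [[]//|e p] [_ [ev _]]; exists e; rewrite ?mem_head. Qed.

Lemma closed_path_return v p e : closed_path v p -> e \in p ->
  exists q, gpath (src e) v q.
Proof.
move=> [_ pv] /splitPr ep; case: ep pv => p1 p2 /gpath_split[w _ /= [ew p2v]].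
by exists (e :: p2).
Qed.

(** Dependent choice. *)
Lemma infinite_path_in (P : set (edge E)) e0 : P e0 ->
  (forall e, P e -> exists2 f, P f & src f = rg e) ->
  exists2 x : nat -> edge E, infinite_path x & forall i, P (x i).
Proof.
move=> P0 Pnext.
have /boolp.choice[nxt nxtP] e : exists f, P e -> P f /\ src f = rg e.
  have [/Pnext[f Pf fe]|nP] := pselect (P e); first by exists f.
  by exists e.
have Px i : P (iter i nxt e0) by elim: i => //= i /nxtP[].
by exists (fun i => iter i nxt e0) => // i; have [_ ->] := nxtP _ (Px i).
Qed.

(** * The graph conditions *)

(** Along a closed path without exits there is no choice of the next edge, so
    two paths that start on it are comparable. *)
Lemma no_exit_comparable v p u a b q r : closed_path v p ->
  ~ (exists f, is_exit p f) ->
  (exists2 e, e \in p & src e = u) -> gpath u a q -> gpath u b r ->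
  (exists t, r = q ++ t) \/ (exists t, q = r ++ t).
Proof.
move=> pv noexit.
have det e f : e \in p -> src f = src e -> f = e.
  by move=> ep fe; apply: contrapT => nfe; apply: noexit; exists f, e.
elim: q u r => [|f q IHq] u [|g r] [e ep eu] /=.
- by left; exists [::].
- by left; exists (g :: r).
- by right; exists (f :: q).
move=> [fu qa] [gu rb].
have fe : f = e by apply: det => //; rewrite fu.
have ge : g = e by apply: det => //; rewrite gu.
subst f g; have := IHq _ r (closed_path_next pv ep) qa rb.
by case=> -[t ->]; [left|right]; exists t.
Qed.

Lemma condition_K_L : condition_K E -> condition_L E.
Proof.
move=> K v p pv; apply: contrapT => noexit.
have [/(_ p)//|[q [r [qr [[q0 qv] qN] [[r0 rv] rN]]]]] := K v.
(* The first edge after [s] would start at the base. *)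
have no_prefix s t : s <> [::] -> gpath v v s -> gpath v v (s ++ t) ->
    (forall e, e \in behead (s ++ t) -> src e <> v) -> t = [::].
  case: s => // e s _ sv /gpath_split[w sw tw] N.
  have wv : w = v := gpath_end sw sv.
  case: t tw N => // f t /= [fw _] /(_ f); rewrite mem_cat mem_head orbT fw wv.
  by move/(_ isT).
have pb := closed_path_base pv.
have [[t rt]|[t qt]] := no_exit_comparable pv noexit pb qv rv.
- move: rv rN; rewrite rt => rv /(no_prefix _ _ q0 qv rv) t0.
  by apply: qr; rewrite rt t0 cats0.
- move: qv qN; rewrite qt => qv /(no_prefix _ _ r0 rv qv) t0.
  by apply: qr; rewrite qt t0 cats0.
Qed.

(** Cofinality brings the exit of a simple closed path back to its base, and
    this detour is a second simple closed path. *)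
Lemma condition_L_K : cofinal E -> condition_L E -> condition_K E.
Proof.
move=> cof L v.
have [[p pv]|none] := pselect (exists p, closed_path v p); last first.
  by left=> p pv; apply: none; exists p.
right; have {p pv}[p [pv pN]] := closed_path_simple pv.
have [f [e [ep fe nfe]]] := L v p pv.
have [e0 e0p _] := closed_path_base pv.
have [x xinf xp] := infinite_path_in (P := [set` p]) e0p
  (fun e => closed_path_next pv).
have [i [q qi]] := cof x (rg f) xinf.
have [r ri] := closed_path_return pv (xp i).
have [t tv tN] := gpath_first_visit (gpath_cat qi ri).
case/splitPr: ep => p1 p2 in pv pN xp *.
have [w p1w /= [ew _]] := gpath_split pv.2.
exists (p1 ++ e :: p2), (p1 ++ f :: t); split=> //.
  move/eqP; rewrite eqseq_cat// eqxx /= => /eqP[ef _].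
  exact: nfe.
split; first split.
- by case: p1 {pv pN xp p1w}.
- by apply: gpath_cat p1w _; rewrite /= fe.
- move=> g; case: p1 pN {pv xp p1w} => [|h p1] /= pN; first exact: tN.
  rewrite mem_cat inE => /or3P[gp1|/eqP->|/tN//].
    by apply: pN; rewrite mem_cat gp1.
  by rewrite fe; apply: pN; rewrite mem_cat mem_head orbT.
Qed.

(** A path from a regular vertex to [T] either begins with an edge, whose range
    reaches [T] as well, or has length 0; the hypothesis on the regular vertices
    of [T] provides such an edge in the second case too. *)
Lemma unreaching_saturated_hereditary (T : set (vertex E)) :
  (forall v, T v -> regular v ->
     exists e u p, [/\ src e = v, T u & gpath (rg e) u p]) ->
  let H := [set w | ~ exists u p, T u /\ gpath w u p] in
  hereditary H /\ saturated H.
Proof.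
move=> Tback H; split=> [e He [u [p [Tu pu]]]|v vreg vH [u [p [Tu pu]]]].
  by apply: He; exists u, (e :: p).
case: p pu => [/= vu|e p /= [ev pu]].
  rewrite -vu in Tu; have [e [u' [p [eu Tu' pu']]]] := Tback v Tu vreg.
  by apply: (vH (rg e)); [exists e | exists u', p].
by apply: (vH (rg e)); [exists e | exists u, p].
Qed.

(** The form used twice below: [T] is the set of the vertices of an infinite
    path, or consists of one sink. *)
Lemma trivial_reaching (T : set (vertex E)) v w :
  only_trivial_saturated_hereditary E ->
  (forall v, T v -> regular v ->
     exists e u p, [/\ src e = v, T u & gpath (rg e) u p]) ->
  T v -> exists u p, T u /\ gpath w u p.
Proof.
move=> triv /unreaching_saturated_hereditary[hH sH] Tv.
have [H0|HT] := triv _ hH sH.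
  apply: contrapT => nw.
  by have : set0 w by rewrite -H0.
have [] : [set w | ~ exists u p, T u /\ gpath w u p] v by rewrite HT.
by exists v, [::].
Qed.

Lemma trivial_cofinal : only_trivial_saturated_hereditary E -> cofinal E.
Proof.
move=> triv x v xinf.
pose T := [set u | exists i, u = src (x i)].
have back u : T u -> regular u -> exists e u' p,
    [/\ src e = u, T u' & gpath (rg e) u' p].
  by move=> [i ->] _; exists (x i), (src (x i.+1)), [::]; split=> //=; exists i.+1.
have [|_ [p [[i ->] pv]]] := trivial_reaching v triv back (v := src (x 0)).
  by exists 0.
by exists i, p.
Qed.

Lemma trivial_sinks_reachable :
  only_trivial_saturated_hereditary E -> sinks_reachable E.
Proof.
move=> triv v w vsink.
have back u : [set v] u -> regular u -> exists e u' p,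
    [/\ src e = u, [set v] u' & gpath (rg e) u' p].
  by move=> -> [[e]]; rewrite vsink.
by have [|_ [p [-> pv]]] := trivial_reaching w triv back (v := v); last by exists p.
Qed.

Lemma row_finite_regular v : row_finite E -> ~ sink v -> regular v.
Proof. by move=> rf /eqP/set0P nv; split=> //; exact: rf. Qed.

Lemma saturated_step (H : set (vertex E)) v : saturated H -> regular v ->
  ~ H v -> exists2 e, src e = v & ~ H (rg e).
Proof.
move=> sH vreg nHv; apply: contrapT => none; apply: nHv; apply: sH => //.
by move=> _ [e ev <-]; apply: contrapT => nHe; apply: none; exists e.
Qed.

(** Outside a proper saturated hereditary set one can walk until one meets a
    sink, or forever; every vertex reaches this walk, hence lies outside too. *)
Lemma cofinal_trivial : row_finite E -> cofinal E -> sinks_reachable E ->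
  only_trivial_saturated_hereditary E.
Proof.
move=> rf cof sinks H hH sH.
have [HT|] := pselect (H = setT); first by right.
move/eqP/setTPn => -[u nHu]; left.
apply/eqP; rewrite -[_ == _]negbK; apply/negP => /set0P[w Hw].
have [[v [vsink nHv]]|nosink] := pselect (exists v, sink v /\ ~ H v).
  by have [p /hereditary_gpath-/(_ _ hH Hw)] := sinks v w vsink.
have step v : ~ H v -> exists2 e, src e = v & ~ H (rg e).
  move=> nHv; apply: saturated_step => //; apply: row_finite_regular => // vs.
  by apply: nosink; exists v.
have [e0 _ e0H] := step u nHu.
have [||x xinf xH] := @infinite_path_in [set e | ~ H (rg e)] e0 => //.
  by move=> e /= /step[f fe nHf]; exists f.
have [i [p pw]] := cof (fun i => x i.+1) w (fun i => xinf i.+1).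
by apply: (xH i); rewrite xinf; exact: hereditary_gpath pw Hw.
Qed.

End Graphs.

(** * Leavitt path algebras: units and ideals *)

Section Algebras.

Variables (R : comNzRingType) (A : nualgType R).

Lemma numul0x (x : A) : 0 ** x = 0.
Proof. by apply: (addrI (0 ** x)); rewrite -numulDl !addr0. Qed.

Lemma numulx0 (x : A) : x ** 0 = 0.
Proof. by apply: (addrI (x ** 0)); rewrite -numulDr !addr0. Qed.

Lemma numul_suml I (s : seq I) (F : I -> A) x :
  (\sum_(i <- s) F i) ** x = \sum_(i <- s) F i ** x.
Proof.
elim: s => [|i s IHs]; first by rewrite !big_nil numul0x.
by rewrite !big_cons numulDl IHs.
Qed.

Lemma numul_sumr I (s : seq I) (F : I -> A) x :
  x ** (\sum_(i <- s) F i) = \sum_(i <- s) x ** F i.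
Proof.
elim: s => [|i s IHs]; first by rewrite !big_nil numulx0.
by rewrite !big_cons numulDr IHs.
Qed.

Lemma ideal_add (I : set A) x y : ideal I -> I x -> I y -> I (x + y).
Proof.
move=> [I0 IB _ _] Ix Iy; rewrite -[y]opprK; apply: (IB) => //.
by rewrite -sub0r; exact: IB.
Qed.

Lemma ideal_sum (I : set A) T (s : seq T) (F : T -> A) :
  ideal I -> (forall i, I (F i)) -> I (\sum_(i <- s) F i).
Proof.
move=> idI IF; apply: big_ind => //; first by case: idI.
by move=> x y; exact: ideal_add.
Qed.

End Algebras.

Section Leavitt.

Variables (R : comNzRingType) (E : graph) (L : leavittPathAlgebra R E).
Implicit Types (u v w : vertex E) (e f : edge E) (x y : L).

Notation V := (lpa_vertex L).
Notation B := (lpa_edge L).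
Notation C := (lpa_ghost L).

Let fam := lpa_family L.

Lemma vertex_idem v : V v ** V v = V v.
Proof. by rewrite (lf_orth fam) eqxx. Qed.

Lemma vertex_sum v : regular v -> exists2 s : seq (edge E),
  (forall e, e \in s -> src e = v) & V v = \sum_(e <- s) B e ** C e.
Proof.
move=> vreg; rewrite (lf_sum fam)// fsbig_finite//; last by case: vreg.
eexists; last by [].
by move=> e; rewrite in_fset_set ?inE//; case: vreg.
Qed.

(** These finite sums of vertices serve as local units. *)
Definition unit_of (s : seq (vertex E)) : L := \sum_(v <- undup s) V v.

Lemma vertex_unit v s : v \in s -> V v ** unit_of s = V v.
Proof.
move=> vs; rewrite numul_sumr (bigD1_seq v) ?mem_undup ?undup_uniq//=.
rewrite vertex_idem big1 ?addr0// => w wv.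
by rewrite (lf_orth fam) eq_sym (negbTE wv).
Qed.

Lemma unit_vertex v s : v \in s -> unit_of s ** V v = V v.
Proof.
move=> vs; rewrite numul_suml (bigD1_seq v) ?mem_undup ?undup_uniq//=.
rewrite vertex_idem big1 ?addr0// => w wv.
by rewrite (lf_orth fam) (negbTE wv).
Qed.

Lemma unit_sub s t : {subset s <= t} ->
  unit_of s ** unit_of t = unit_of s /\ unit_of t ** unit_of s = unit_of s.
Proof.
move=> st; rewrite {1 4}/unit_of numul_suml numul_sumr.
by split; rewrite /unit_of; apply: eq_big_seq => v; rewrite mem_undup => /st vt;
   [exact: vertex_unit|exact: unit_vertex].
Qed.

(** The elements with a two-sided unit of this form are a subalgebra, because
    the units for two elements have a common enlargement. *)
Lemma local_units x : exists s, unit_of s ** x = x /\ x ** unit_of s = x.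
Proof.
pose S := [set x : L | exists s, unit_of s ** x = x /\ x ** unit_of s = x].
have widen (s t : seq (vertex E)) y : {subset s <= t} ->
    unit_of s ** y = y /\ y ** unit_of s = y ->
    unit_of t ** y = y /\ y ** unit_of t = y.
  move=> /unit_sub[st ts] [sy ys]; split.
    by rewrite -sy numulA ts.
  by rewrite -ys -numulA st.
have inl (s t : seq (vertex E)) : {subset s <= s ++ t}.
  by move=> z; rewrite mem_cat => ->.
have inr (s t : seq (vertex E)) : {subset t <= s ++ t}.
  by move=> z; rewrite mem_cat orbC => ->.
suff ST : S = setT by have : S x by rewrite ST.
apply: (lpa_generated (l := L)); first split.
- by exists [::]; rewrite numulx0 numul0x.
- move=> y z [s ys] [t zt]; exists (s ++ t); rewrite numulDl numulDr.
  have [-> ->] := widen _ _ _ (inl s t) ys.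
  by have [-> ->] := widen _ _ _ (inr s t) zt.
- by move=> c y [s [sy ys]]; exists s; rewrite -nuscalerAr -nuscalerAl sy ys.
- move=> y z [s ys] [t zt]; exists (s ++ t); rewrite numulA -[_ ** unit_of _]numulA.
  have [-> _] := widen _ _ _ (inl s t) ys.
  by have [_ ->] := widen _ _ _ (inr s t) zt.
- by move=> v; exists [:: v]; rewrite vertex_unit ?unit_vertex ?mem_head.
- move=> e; exists [:: src e; rg e].
  rewrite -[B e](lf_srcl fam) numulA unit_vertex ?mem_head//; split=> //.
  by rewrite (lf_srcl fam) -[B e](lf_rgr fam) -numulA vertex_unit// !inE eqxx orbT.
- move=> e; exists [:: src e; rg e].
  rewrite -[C e](lf_rgl fam) numulA unit_vertex ?inE ?eqxx ?orbT//; split=> //.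
  by rewrite (lf_rgl fam) -[C e](lf_srcr fam) -numulA vertex_unit// mem_head.
Qed.

Lemma nonzero_right_vertex x : x <> 0 -> exists v, x ** V v <> 0.
Proof.
move=> x0; apply: contrapT => none; apply: x0.
have [s [_ <-]] := local_units x; rewrite numul_sumr big1// => v _.
by apply: contrapT => xv; apply: none; exists v.
Qed.

Lemma nonzero_left_vertex x : x <> 0 -> exists v, V v ** x <> 0.
Proof.
move=> x0; apply: contrapT => none; apply: x0.
have [s [<- _]] := local_units x; rewrite numul_suml big1// => v _.
by apply: contrapT => xv; apply: none; exists v.
Qed.

Lemma ideal_full (I : set L) : ideal I -> (forall v, I (V v)) -> I = setT.
Proof.
move=> idI IV; rewrite -subTset => x _; have [s [<- _]] := local_units x.
by have [_ _ _ IM] := idI; apply: IM; exact: ideal_sum.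
Qed.

Lemma ideal_vertices_hereditary (I : set L) :
  ideal I -> hereditary [set v | I (V v)].
Proof.
move=> [_ _ IMl IMr] e /= Ie.
have -> : V (rg e) = C e ** V (src e) ** B e.
  by rewrite (lf_srcr fam) (lf_ghost fam) eqxx.
by apply: IMr; exact: IMl.
Qed.

Lemma ideal_vertices_saturated (I : set L) :
  ideal I -> saturated [set v | I (V v)].
Proof.
move=> idI v /vertex_sum[s sv /= ->] vI; rewrite big_seq; apply: big_ind.
- by case: idI.
- by move=> y z; exact: ideal_add.
move=> e /sv ev; rewrite -(lf_rgr fam); have [_ _ IMl IMr] := idI.
by apply: IMr; apply: IMl; apply: vI; exists e.
Qed.

(** * Reduction to paths of real edges *)

Fixpoint path_elt (p : seq (edge E)) v : L :=
  if p is e :: p' then B e ** path_elt p' v else V v.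

Definition path_comb (s : seq (R * seq (edge E))) v : L :=
  \sum_(i <- s) i.1 *: path_elt i.2 v.

Lemma vertex_path_elt u v p : gpath u v p -> V u ** path_elt p v = path_elt p v.
Proof.
case: p => [|e p] /=; first by move=> ->; rewrite vertex_idem.
by move=> [<- _]; rewrite numulA (lf_srcl fam).
Qed.

Lemma path_elt_rcons p e : path_elt p (src e) ** B e = path_elt (rcons p e) (rg e).
Proof.
elim: p => [|f p IHp] /=; first by rewrite (lf_srcl fam) (lf_rgr fam).
by rewrite -numulA IHp.
Qed.

Lemma path_combMedge s e : path_comb s (src e) ** B e =
  path_comb [seq (i.1, rcons i.2 e) | i <- s] (rg e).
Proof.
rewrite /path_comb big_map numul_suml; apply: eq_bigr => i _ /=.
by rewrite -nuscalerAl path_elt_rcons.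
Qed.

Lemma path_comb_nil v : path_comb [::] v = 0.
Proof. exact: big_nil. Qed.

Lemma path_comb_cat s t v : path_comb (s ++ t) v = path_comb s v + path_comb t v.
Proof. exact: big_cat. Qed.

(** The span of the paths. Membership is tested on the corners
    [V u ** y ** V w], in order that all paths of a combination have common end
    points. *)
Definition real_part : set L := [set y | forall u w, exists2 s,
  (forall i, i \in s -> gpath u w i.2) & V u ** y ** V w = path_comb s w].

Lemma real_part0 : real_part 0.
Proof. by move=> u w; exists [::] => //; rewrite numulx0 numul0x path_comb_nil. Qed.

Lemma real_partD x y : real_part x -> real_part y -> real_part (x + y).
Proof.
move=> xP yP u w; have [s sP xs] := xP u w; have [t tP yt] := yP u w.
exists (s ++ t); last by rewrite numulDr numulDl xs yt path_comb_cat.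
by move=> i; rewrite mem_cat => /orP[/sP|/tP].
Qed.

Lemma real_partZ c x : real_part x -> real_part (c *: x).
Proof.
move=> xP u w; have [s sP xs] := xP u w.
exists [seq (c * i.1, i.2) | i <- s]; first by move=> _ /mapP[i /sP ip ->].
rewrite -nuscalerAr -nuscalerAl xs /path_comb big_map scaler_sumr.
by apply: eq_bigr => i _; rewrite scalerA.
Qed.

Lemma real_part_vertex v : real_part (V v).
Proof.
move=> u w; rewrite (lf_orth fam); case: eqP => [->|_]; last first.
  by exists [::]; rewrite // numul0x path_comb_nil.
rewrite (lf_orth fam); case: eqP => [->|_]; last first.
  by exists [::]; rewrite // path_comb_nil.
exists [:: (1, [::])]; first by move=> i; rewrite inE => /eqP->.
by rewrite /path_comb big_seq1 scale1r.
Qed.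

Lemma real_partMvertex x v : real_part x -> real_part (x ** V v).
Proof.
move=> xP u w; rewrite numulA -numulA (lf_orth fam).
case: eqP => [->|_]; first exact: xP.
by exists [::]; rewrite // numulx0 path_comb_nil.
Qed.

Lemma real_partMedge x e : real_part x -> real_part (x ** B e).
Proof.
move=> xP u w; rewrite -[B e](lf_rgr fam) !numulA.
rewrite -(numulA _ (V (rg e))) (lf_orth fam); case: eqP => [<-|_]; last first.
  by exists [::]; rewrite // numulx0 path_comb_nil.
have [s sP xs] := xP u (src e).
exists [seq (i.1, rcons i.2 e) | i <- s].
  by move=> _ /mapP[i /sP ip ->]; exact: gpath_rcons.
rewrite -[B e](lf_srcl fam) !numulA xs -numulA (lf_rgr fam).
exact: path_combMedge.
Qed.

(** [ghost_depth n] contains the elements that lose all their ghost edges when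
    they are multiplied on the right by a path of length [n], or by a shorter
    one that stops at a sink. *)
Fixpoint ghost_depth (n : nat) : set L :=
  if n is n'.+1 then
    [set x | (forall e, ghost_depth n' (x ** B e)) /\
             (forall v, sink v -> real_part (x ** V v))]
  else real_part.

Lemma ghost_depth0 n : ghost_depth n 0.
Proof.
elim: n => [|n IHn]; first exact: real_part0.
by split=> [e|v _]; rewrite numul0x //; exact: real_part0.
Qed.

Lemma ghost_depthD n x y :
  ghost_depth n x -> ghost_depth n y -> ghost_depth n (x + y).
Proof.
elim: n x y => [|n IHn] x y; first exact: real_partD.
move=> [xB xV] [yB yV]; split=> [e|v vs]; rewrite numulDl.
  exact: IHn (xB e) (yB e).
exact: real_partD (xV v vs) (yV v vs).
Qed.

Lemma ghost_depthS n x : ghost_depth n x -> ghost_depth n.+1 x.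
Proof.
elim: n x => [|n IHn] x.
  by move=> xP; split=> [e|v _]; [exact: real_partMedge|exact: real_partMvertex].
by move=> [xB xV]; split=> // e; exact/IHn/xB.
Qed.

Lemma ghost_depth_leq m n x : (m <= n)%N -> ghost_depth m x -> ghost_depth n x.
Proof.
move=> /subnK <-; elim: (n - m)%N => // k IHk /IHk.
exact: ghost_depthS.
Qed.

Lemma ghost_depthMvertex n x v : ghost_depth n x -> ghost_depth n (x ** V v).
Proof.
case: n => [|n]; first exact: real_partMvertex.
move=> [xB xV]; split=> [e|w ws].
  rewrite -[B e](lf_srcl fam) numulA -[X in X ** _]numulA (lf_orth fam).
  case: eqP => [->|_]; first by rewrite -numulA (lf_srcl fam); exact: xB.
  by rewrite numulx0 numul0x; exact: ghost_depth0.
rewrite -numulA (lf_orth fam); case: eqP => [->|_]; first exact: xV.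
by rewrite numulx0; exact: real_part0.
Qed.

Lemma ghost_depthMedge n x e : ghost_depth n x -> ghost_depth n (x ** B e).
Proof. by move=> /ghost_depthS[xB _]; exact: xB. Qed.

(** [C e ** B f] is a vertex or 0, and [C e ** V v] is 0 for a sink [v] because
    [e] leaves its own source. *)
Lemma ghost_depthMghost n x e : ghost_depth n x -> ghost_depth n.+1 (x ** C e).
Proof.
move=> xn; split=> [f|v vs].
  rewrite -numulA (lf_ghost fam); case: eqP => _; first exact: ghost_depthMvertex.
  by rewrite numulx0; exact: ghost_depth0.
rewrite -numulA -(lf_srcr fam) -numulA (lf_orth fam); case: eqP => [ev|_].
  by have : out_edges v e by []; rewrite vs.
by rewrite !numulx0; exact: real_part0.
Qed.

Lemma ghost_depthZ n c x : ghost_depth n x -> ghost_depth n (c *: x).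
Proof.
elim: n x => [|n IHn] x; first exact: real_partZ.
move=> [xB xV]; split=> [e|v vs]; rewrite -nuscalerAl.
  exact: IHn (xB e).
exact: real_partZ (xV v vs).
Qed.

(** The union of the sets [ghost_depth n] is stable under right multiplication
    by the generators, hence by every element, and it contains local units. *)
Lemma ghost_depth_exists x : exists n, ghost_depth n x.
Proof.
pose S := [set x : L | exists n, ghost_depth n x].
have SD y z : S y -> S z -> S (y + z).
  move=> [m ym] [n zn]; exists (maxn m n); apply: ghost_depthD.
    exact: ghost_depth_leq (leq_maxl _ _) ym.
  exact: ghost_depth_leq (leq_maxr _ _) zn.
pose T := [set z : L | forall y, S y -> S (y ** z)].
have TT : T = setT.
  apply: (lpa_generated (l := L)); first split.
  - by move=> y _; rewrite numulx0; exists 0; exact: ghost_depth0.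
  - by move=> y z yT zT t tS; rewrite numulDr; apply: SD; [exact: yT|exact: zT].
  - move=> c z zT y yS; rewrite -nuscalerAr nuscalerAl; apply: zT.
    by case: yS => n /(ghost_depthZ c) yn; exists n.
  - by move=> y z yT zT t tS; rewrite numulA; exact/zT/yT.
  - by move=> v y [n yn]; exists n; exact: ghost_depthMvertex.
  - by move=> e y [n yn]; exists n; exact: ghost_depthMedge.
  - by move=> e y [n yn]; exists n.+1; exact: ghost_depthMghost.
have [s [<- _]] := local_units x.
have : T x by rewrite TT.
apply; rewrite /unit_of; apply: big_ind => //; first by exists 0; exact: real_part0.
by move=> v _; exists 0; exact: real_part_vertex.
Qed.

Section ReductionInIdeal.

Variable I : set L.
Hypothesis idI : ideal I.
Hypothesis rf : row_finite E.

(** If [v] is not a sink, then [x ** V v] is the sum of the products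
    [x ** B e ** C e], so some [x ** B e] is nonzero when [x ** V v] is; it has
    smaller depth. *)
Lemma nonzero_real_part x : I x -> x <> 0 ->
  exists y, [/\ I y, y <> 0 & real_part y].
Proof.
have [_ _ IMl IMr] := idI.
have [n] := ghost_depth_exists x; elim: n x => [|n IHn] x; first by exists x.
move=> [xB xV] Ix /nonzero_right_vertex[v xv].
have [vs|vs] := pselect (sink v).
  by exists (x ** V v); split; [exact: IMr|by []|exact: xV].
have [s _ vE] := vertex_sum (row_finite_regular rf vs).
have [e xe] : exists e, x ** B e <> 0.
  apply: contrapT => none; apply: xv; rewrite vE numul_sumr big1// => e _.
  rewrite numulA; have -> : x ** B e = 0; last by rewrite numul0x.
  by apply: contrapT => xe; apply: none; exists e.
exact: IHn (xB e) (IMr _ _ Ix) xe.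
Qed.

(** * Reduction to a multiple of a vertex plus closed paths *)

Definition strip_first e (s : seq (R * seq (edge E))) :=
  [seq (i.1, behead i.2) | i <- s & ohead i.2 == Some e].

Lemma ghost_path_comb e s u v : (forall i, i \in s -> gpath u v i.2 /\ i.2 <> [::]) ->
  C e ** path_comb s v = path_comb (strip_first e s) v.
Proof.
move=> sP; rewrite /path_comb /strip_first big_map big_filter numul_sumr.
rewrite [RHS]big_mkcond /=; apply: eq_big_seq => -[c [|f p]] /sP[] //= [_ pv] _.
rewrite -nuscalerAr numulA (lf_ghost fam) /=.
have -> : (Some f == Some e) = (e == f) by rewrite eq_sym.
by case: eqP => [->|_]; rewrite ?vertex_path_elt// numul0x scaler0.
Qed.

(** Left multiplication by a ghost edge shortens all paths of positive length,
    and for a suitable edge the product is nonzero; this is repeated as long as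
    the paths of length 0 cancel. *)
Lemma vertex_plus_closed_paths y : I y -> y <> 0 -> real_part y ->
  exists r v s, [/\ r != 0, forall i, i \in s -> closed_path v i.2
    & I (r *: V v + path_comb s v)].
Proof.
have [_ _ IMl IMr] := idI.
move=> Iy /nonzero_right_vertex[v yv] yP.
have [u uyv] := nonzero_left_vertex yv; have [s sP ys] := yP u v.
move: uyv; rewrite numulA ys => ys0.
have {ys}: I (path_comb s v) by rewrite -ys; apply: IMr; exact: IMl.
have [n sn] : exists n, forall i, i \in s -> (size i.2 <= n)%N.
  exists (\max_(i <- s) size i.2) => i si.
  by rewrite (big_rem i)//= leq_maxl.
elim: n u s sP ys0 sn {y yP yv Iy} => [|n IHn] u s sP s0 sn Is.
  (* All paths have length 0, so the combination is a multiple of [V v]. *)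
  exists (\sum_(i <- s) i.1), v, [::].
  have sE : path_comb s v = (\sum_(i <- s) i.1) *: V v.
    rewrite scaler_suml; apply: eq_big_seq => -[c [|e p]] /sn//.
  rewrite path_comb_nil addr0 -sE; split=> //.
  by apply/eqP => r0; apply: s0; rewrite sE r0 scale0r.
pose s1 := [seq i <- s | i.2 != [::]].
pose r := \sum_(i <- s | i.2 == [::]) i.1.
have sE : path_comb s v = r *: V v + path_comb s1 v.
  rewrite /path_comb (bigID (fun i => i.2 == [::])) /= big_filter scaler_suml.
  by congr (_ + _); apply: eq_bigr => -[c p] /= /eqP->.
have s1P i : i \in s1 -> gpath u v i.2 /\ i.2 <> [::].
  by rewrite mem_filter => /andP[/eqP i0 /sP].
have [r0|r0] := eqVneq r 0.
  rewrite r0 scale0r add0r in sE; rewrite sE in s0 Is.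
  have [e es0] : exists e, C e ** path_comb s1 v <> 0.
    apply: contrapT => none; apply: s0.
    have -> : path_comb s1 v = V u ** path_comb s1 v.
      rewrite numul_sumr; apply: eq_big_seq => i /s1P[iv _].
      by rewrite -nuscalerAr vertex_path_elt.
    have [us|us] := pselect (sink u).
      rewrite /path_comb big_seq big1 ?numulx0// => -[c [|e p]] /s1P[]//= [ue _] _.
      by have : out_edges u e by []; rewrite us.
    have [t _ ->] := vertex_sum (row_finite_regular rf us).
    rewrite numul_suml big1// => e _; rewrite -numulA.
    have -> : C e ** path_comb s1 v = 0; last by rewrite numulx0.
    by apply: contrapT => xe; apply: none; exists e.
  have := IMl (C e) _ Is; move: es0; rewrite (ghost_path_comb e s1P) => s2 Is2.
  apply: (IHn (rg e) (strip_first e s1)) => //.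
    move=> _ /mapP[[c [|f p]] + ->]; rewrite mem_filter => /andP[//= /eqP[->]].
    by move=> /s1P[/= []].
  move=> _ /mapP[[c [|f p]] + ->]; rewrite mem_filter => /andP[//= _].
  by rewrite mem_filter /= => /sn.
exists r, v, s1; rewrite -sE; split=> // i /s1P[iv i0]; split=> //.
suff uv : u = v by rewrite -{1}uv.
apply: contrapT => uv; move: r0; rewrite /r big_seq_cond big1 ?eqxx//.
by move=> [c p] /= /andP[/sP + /eqP p0]; rewrite p0.
Qed.

(** * Removing the closed paths by means of exits *)

Definition rotate_first e (s : seq (R * seq (edge E))) :=
  [seq (i.1, rcons (behead i.2) e) | i <- s & ohead i.2 == Some e].

Lemma conj_edge e r s : (forall i, i \in s -> closed_path (src e) i.2) ->
  C e ** (r *: V (src e) + path_comb s (src e)) ** B e =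
  r *: V (rg e) + path_comb (rotate_first e s) (rg e).
Proof.
move=> sP; rewrite numulDr numulDl -nuscalerAr (lf_srcr fam) -nuscalerAl.
rewrite (lf_ghost fam) eqxx (@ghost_path_comb e s (src e)).
  by rewrite path_combMedge /strip_first -map_comp.
by move=> i /sP[].
Qed.

Lemma rotate_first_closed e s :
  (forall i, i \in s -> closed_path (src e) i.2) ->
  forall i, i \in rotate_first e s -> closed_path (rg e) i.2.
Proof.
move=> sP _ /mapP[[c [|f p]] + ->]; rewrite mem_filter => /andP[//= /eqP[->]].
by move=> /sP[_ /= [_ pe]]; split; [case: (p)|exact: gpath_rcons].
Qed.

Lemma size_rotate_first e s : (size (rotate_first e s) <= size s)%N.
Proof. by rewrite size_map size_filter count_size. Qed.

(** Conjugation by an edge turns the closed paths beginning with this edge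
    around and removes the others. If one follows a closed path of the
    combination up to an exit [f] and conjugates by [f], this path is removed. *)
Lemma remove_closed_path p1 p2 e f c r s v : src f = src e -> f <> e ->
  (forall i, i \in s -> closed_path v i.2) -> (c, p1 ++ e :: p2) \in s ->
  I (r *: V v + path_comb s v) ->
  exists w t, [/\ (size t < size s)%N, forall i, i \in t -> closed_path w i.2
    & I (r *: V w + path_comb t w)].
Proof.
have [_ _ IMl IMr] := idI.
move=> fe nfe; elim: p1 p2 s v => [|g p1 IHp1] p2 s v sP es Is.
  have [_ /= [ev _]] := sP _ es; rewrite -ev -fe in sP Is.
  exists (rg f), (rotate_first f s); split.
  - rewrite size_map size_filter ltn_neqAle count_size andbT -all_count.
    by apply/negP => /allP/(_ _ es)/= /eqP[/esym].
  - exact: rotate_first_closed.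
  - by rewrite -conj_edge//; apply: IMr; exact: IMl.
have [_ /= [gv _]] := sP _ es; rewrite -gv in sP Is.
have [|||w [t [ts tP It]]] := IHp1 (rcons p2 g) (rotate_first g s) (rg g).
- exact: rotate_first_closed.
- apply/mapP; exists (c, g :: p1 ++ e :: p2); last by rewrite /= rcons_cat.
  by rewrite mem_filter /= eqxx.
- by rewrite -conj_edge//; apply: IMr; exact: IMl.
by exists w, t; split=> //; exact: leq_trans ts (size_rotate_first g s).
Qed.

Lemma scaled_vertex_in_ideal x : condition_L E -> I x -> x <> 0 ->
  exists r v, r != 0 /\ I (r *: V v).
Proof.
move=> condL Ix x0; have [y [Iy y0 yP]] := nonzero_real_part Ix x0.
have [r [v [s [r0 sP Is]]]] := vertex_plus_closed_paths Iy y0 yP.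
have [n] := ubnP (size s).
elim: n v s sP Is => // n IHn v [|[c p] s] sP Is sn.
  by exists r, v; rewrite path_comb_nil addr0 in Is.
have [f [e [ep fe nfe]]] := condL v p (sP _ (mem_head _ _)).
case/splitPr: ep sP Is => p1 p2 sP Is.
have [w [t [ts tP It]]] := remove_closed_path fe nfe sP (mem_head _ _) Is.
by apply: IHn tP It _; exact: leq_trans ts sn.
Qed.

End ReductionInIdeal.

Lemma condition_L_basically_simple : row_finite E -> condition_L E ->
  only_trivial_saturated_hereditary E -> basically_simple L.
Proof.
move=> rf condL triv I [idI basicI].
have [I0|I0] := pselect (I = [set 0]); [by left|right].
have [x Ix x0] : exists2 x, I x & x <> 0.
  apply: contrapT => none; apply: I0; rewrite eqEsubset; split=> [x Ix|_ ->].
    by apply: contrapT => x0; apply: none; exists x.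
  by case: idI.
have [r [v [r0 Irv]]] := scaled_vertex_in_ideal idI rf condL Ix x0.
have [H0|HT] := triv _ (ideal_vertices_hereditary idI) (ideal_vertices_saturated idI).
  have : [set v | I (V v)] v by exact: basicI Irv.
  by rewrite H0.
by apply: ideal_full => // w; have : [set v | I (V v)] w by rewrite HT.
Qed.

End Leavitt.

(** * Leavitt families of operators on functions *)

Section Endomorphisms.

Variables (R : comNzRingType) (U : lmodType R).

Definition linear_pred : {pred U -> U} :=
  fun f => `[< forall (c : R) x y, f (c *: x + y) = c *: f x + f y >].

Lemma linear_pred_submod : submod_closed linear_pred.
Proof.
split=> [|c f g /asboolP fl /asboolP gl]; apply/asboolP => d x y.
  by rewrite /= scaler0 addr0.
rewrite !fctE fl gl !scalerDr !scalerA [d * c]mulrC -!addrA; congr (_ + _).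
by rewrite addrCA.
Qed.

HB.instance Definition _ :=
  GRing.isSubmodClosed.Build R (U -> U) linear_pred linear_pred_submod.

Record endo := Endo { endo_fun :> U -> U; endo_linear : endo_fun \in linear_pred }.

HB.instance Definition _ := [isSub for endo_fun].
HB.instance Definition _ := [Choice of endo by <:].
HB.instance Definition _ := [SubChoice_isSubLmodule of endo by <:].

Lemma endoP (f g : endo) : f =1 g -> f = g.
Proof. by move=> fg; apply: val_inj; apply/funext. Qed.

Lemma endo_lin (f : endo) c x y : f (c *: x + y) = c *: f x + f y.
Proof. by have /asboolP := endo_linear f. Qed.

Lemma endoD (f g : endo) x : (f + g) x = f x + g x.
Proof. by []. Qed.

Lemma endo_sum I (s : seq I) (F : I -> endo) x :
  (\sum_(i <- s) F i) x = \sum_(i <- s) F i x.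
Proof.
elim: s => [|i s IHs]; first by rewrite !big_nil.
by rewrite !big_cons endoD IHs.
Qed.

Lemma comp_linear (f g : endo) : f \o g \in linear_pred.
Proof. by apply/asboolP => c x y /=; rewrite !endo_lin. Qed.

Definition endo_comp (f g : endo) := Endo (comp_linear f g).

Lemma endo_compA : associative endo_comp.
Proof. by move=> f g h; exact: endoP. Qed.

Lemma endo_compDl : left_distributive endo_comp +%R.
Proof. by move=> f g h; exact: endoP. Qed.

Lemma endo_compDr : right_distributive endo_comp +%R.
Proof.
move=> f g h; apply: endoP => x.
by have := endo_lin f 1 (g x) (h x); rewrite !scale1r.
Qed.

Lemma endo_compZl c (f g : endo) : c *: endo_comp f g = endo_comp (c *: f) g.
Proof. exact: endoP. Qed.

Lemma endo_compZr c (f g : endo) : c *: endo_comp f g = endo_comp f (c *: g).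
Proof.
have f0 : f 0 = 0.
  by have := endo_lin f (-1) 0 0; rewrite addr0 scaler0 scaleN1r addNr.
by apply: endoP => x; have := endo_lin f c (g x) 0; rewrite f0 !addr0.
Qed.

HB.instance Definition _ := Lmodule_isNUAlgebra.Build R endo
  endo_compA endo_compDl endo_compDr endo_compZl endo_compZr.

Lemma endoM (f g : endo) x : (f ** g) x = f (g x).
Proof. by []. Qed.

End Endomorphisms.

Section PartialShifts.

Variables (R : comNzRingType) (X : Type).
Implicit Types (phi psi : X -> option X).

Lemma pshift_linear phi :
  (fun (f : X -> R^o) x => oapp f 0 (phi x)) \in @linear_pred R (X -> R^o).
Proof.
apply/asboolP => c f g; apply/funext => x; rewrite !fctE.
by case: (phi x) => [y|] //=; rewrite scaler0 addr0.
Qed.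

(** All generators act by operators of this kind, so that most of the Leavitt
    relations become identities between composites of partial maps. *)
Definition pshift phi : endo (X -> R^o) := Endo (pshift_linear phi).

Lemma pshiftM phi psi :
  pshift phi ** pshift psi = pshift (fun x => obind psi (phi x)).
Proof. by apply: endoP => f; apply/funext => x; rewrite endoM /=; case: (phi x). Qed.

Lemma eq_pshift phi psi : phi =1 psi -> pshift phi = pshift psi.
Proof. by move=> /funext->. Qed.

Lemma pshift_none phi : (forall x, phi x = None) -> pshift phi = 0.
Proof. by move=> phi0; apply: endoP => f; apply/funext => x /=; rewrite phi0. Qed.

End PartialShifts.

Section Representation.

Variables (R : comNzRingType) (E : graph) (H : set (vertex E)) (t : int).
Hypotheses (rf : row_finite E) (hH : hereditary H) (sH : saturated H).
Implicit Types (v w : vertex E) (e f : edge E) (m : int).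

(** The edges of [v] in the quotient graph by [H]. *)
Definition outs v : seq (edge E) :=
  [seq e <- finmap.enum_fset (fset_set (out_edges v)) | ~~ `[< H (rg e) >]].

Lemma mem_outs e v : (e \in outs v) = (src e == v) && ~~ `[< H (rg e) >].
Proof.
rewrite mem_filter in_fset_set; last exact: rf.
by rewrite andbC; congr (_ && _); apply/idP/eqP; rewrite inE.
Qed.

Lemma outs_uniq v : uniq (outs v).
Proof. by rewrite filter_uniq// finmap.fset_uniq. Qed.

Lemma outs_avoid e v : e \in outs v -> ~~ `[< H v >].
Proof.
rewrite mem_outs => /andP[/eqP<-]; apply: contra => /asboolP/hH He.
exact/asboolP.
Qed.

Local Notation k v := (size (outs v))%:Z.

Definition shift_vertex v (x : vertex E * int) :=
  if (x.1 == v) && ~~ `[< H v >] then Some x else None.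

(** The points [(v, m)] over a vertex [v] outside [H] are distributed according
    to the residue of [m - t] modulo the number of the edges that leave [v] and
    avoid [H]; each residue class is a copy of the points over the range of the
    corresponding edge. *)
Definition shift_edge e (x : vertex E * int) :=
  if (e \in outs x.1) && (((x.2 - t) %% k x.1)%Z == index e (outs x.1))
  then Some (rg e, ((x.2 - t) %/ k x.1)%Z) else None.

Definition shift_ghost e (x : vertex E * int) :=
  if (x.1 == rg e) && ~~ `[< H (rg e) >]
  then Some (src e, x.2 * k (src e) + (index e (outs (src e)))%:Z + t) else None.

(** Euclidean division by the number of edges makes [shift_edge e] and
    [shift_ghost e] mutually inverse, and every point over a regular vertex
    outside [H] has exactly one residue. The saturation of [H] ensures that
    there is at least one edge to divide by. *)
Lemma shift_family : leavitt_family (fun v => pshift R (shift_vertex v))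
  (fun e => pshift R (shift_edge e)) (fun e => pshift R (shift_ghost e)).
Proof.
have gt e : ~~ `[< H (rg e) >] -> e \in outs (src e).
  by rewrite mem_outs eqxx.
split=> [v w|e|e|e|e|e f|v vreg]; rewrite ?pshiftM.
- case: eqP => [<-|vw].
    apply: eq_pshift => -[u m]; rewrite /shift_vertex /=.
    by case: ifP => //= uv; rewrite uv.
  apply: pshift_none => -[u m]; rewrite /shift_vertex /=.
  by case: ifP => //= /andP[/eqP-> _]; case: eqP.
- apply: eq_pshift => -[u m]; rewrite /shift_vertex /=; case: ifP => //=.
  rewrite /shift_edge /= => ue; case: ifP => // /andP[eu _]; case/negP: ue.
  have := eu; rewrite mem_outs => /andP[/eqP eu' _]; rewrite eu' eqxx /=.
  exact: outs_avoid eu.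
- apply: eq_pshift => -[u m]; rewrite /shift_edge /=; case: ifP => //=.
  rewrite mem_outs => /andP[/andP[_ eH] _].
  by rewrite /shift_vertex /= eqxx eH.
- apply: eq_pshift => -[u m]; rewrite /shift_vertex /=; case: ifP => //= ue.
  by rewrite /shift_ghost /= ue.
- apply: eq_pshift => -[u m]; rewrite /shift_ghost /=; case: ifP => //=.
  by move=> /andP[_ /gt /outs_avoid eH]; rewrite /shift_vertex /= eqxx eH.
- have comp u m : obind (shift_edge f) (shift_ghost e (u, m)) =
      if [&& u == rg e, ~~ `[< H (rg e) >] & e == f] then Some (u, m) else None.
    rewrite /shift_ghost /=; have [->|_] := eqVneq u (rg e) => //=.
    case: ifP => //= /gt eo; rewrite /shift_edge /= addrK.
    have ei : (index e (outs (src e)) < size (outs (src e)))%N by rewrite index_mem.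
    have k0 : k (src e) != 0 by rewrite -lt0n (leq_trans _ ei).
    rewrite modzMDl modz_small ?divzMDl// ?divz_small ?addr0//.
    have [<-|ef] := eqVneq e f; first by rewrite eo eqxx.
    case: ifP => // /andP[fo /eqP[]] /(congr1 (nth e (outs (src e)))).
    by rewrite !nth_index// => /eqP; rewrite (negbTE ef).
  case: eqP => [ef|ef]; [apply: eq_pshift|apply: pshift_none] => -[u m];
    rewrite comp.
    by rewrite -ef eqxx andbT.
  by move/eqP/negbTE: ef ->; rewrite !andbF.
rewrite fsbig_finite; last by case: vreg.
apply: endoP => g; apply/funext => -[u m].
have term e : (pshift R (shift_edge e) ** pshift R (shift_ghost e)) g (u, m) =
    if (e \in outs u) && (((m - t) %% k u)%Z == index e (outs u))
    then g (u, m) else 0.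
  rewrite pshiftM /= /shift_edge /=; case: ifP => //= /andP[eo /eqP mi].
  have := eo; rewrite mem_outs => /andP[/eqP eu eH].
  rewrite /shift_ghost /= eqxx eH /= eu -mi -divz_eq subrK.
  by [].
rewrite endo_sum fct_sumE (eq_bigr _ (fun e _ => term e)) /=.
rewrite /shift_vertex /=; case: ifP => [/andP[/eqP-> vH]|uv] /=; last first.
  rewrite big_seq big1// => e; rewrite in_fset_set ?inE; last by case: vreg.
  move=> ev; case: ifP => // /andP[eo _]; case/negP: uv.
  have := eo; rewrite mem_outs ev => /andP[/eqP-> _]; rewrite eqxx.
  exact: outs_avoid eo.
have [e ev eH] : exists2 e, src e = v & ~ H (rg e).
  by apply: saturated_step => //; apply/asboolPn.
have eo : e \in outs v by rewrite mem_outs ev eqxx; apply/asboolPn.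
have s0 : (0 < size (outs v))%N by case: (outs v) eo.
have k0 : k v != 0 by rewrite -lt0n.
have : (absz ((m - t) %% k v)%Z < size (outs v))%N.
  by rewrite -ltz_nat gez0_abs ?modz_ge0// ltz_pmod.
set i := absz _ => iv.
have mi : ((m - t) %% k v)%Z = i by rewrite /i gez0_abs ?modz_ge0.
pose e' := nth e (outs v) i.
have e'o : e' \in outs v by exact: mem_nth.
rewrite (bigD1_seq e') ?finmap.fset_uniq //=; last first.
  rewrite in_fset_set ?inE; last by case: vreg.
  by move: e'o; rewrite mem_outs => /andP[/eqP].
rewrite mi e'o index_uniq// ?outs_uniq// eqxx big1 ?addr0// => f fe'.
case: ifP => // /andP[fo /eqP[fi]]; case/eqP: fe'.
by rewrite /e' fi nth_index.
Qed.

End Representation.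

(** * Basic ideals that are kernels *)

Section Kernels.

Variables (R : comNzRingType) (E : graph) (L : leavittPathAlgebra R E).
Hypothesis rf : row_finite E.
Implicit Types (v w : vertex E) (e : edge E).

Lemma hom_kernel_ideal (A : nualgType R) (f : L -> A) :
  nualg_hom f -> ideal [set x | f x = 0].
Proof.
move=> [fD fZ fM]; have f0 : f 0 = 0 by have := fZ 0 0; rewrite !scale0r.
split=> //= [x y fx fy|a x fx|a x fx].
- by rewrite fD -scaleN1r fZ fx fy scaler0 addr0.
- by rewrite fM fx numulx0.
- by rewrite fM fx numul0x.
Qed.

Lemma shift_hom (H : set (vertex E)) t : hereditary H -> saturated H ->
  exists f : L -> endo (vertex E * int -> R^o),
    [/\ nualg_hom f, forall v, f (lpa_vertex L v) = pshift R (shift_vertex H v)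
      & forall e, f (lpa_edge L e) = pshift R (shift_edge H t e)].
Proof.
move=> hH sH; have [f [fhom fV fB _]] := lpa_universal L (shift_family R t rf hH sH).
by exists f.
Qed.

(** Outside [H] the vertex fixes the points over it, so a multiple [c v] sends
    the constant function 1 to a function with value [c]. *)
Lemma shift_kernel_vertex (H : set (vertex E)) (f : L -> endo (vertex E * int -> R^o)) :
  nualg_hom f -> (forall v, f (lpa_vertex L v) = pshift R (shift_vertex H v)) ->
  forall c v, c != 0 -> f (c *: lpa_vertex L v) = 0 <-> H v.
Proof.
move=> [_ fZ _] fV c v c0; rewrite fZ fV; split=> [fv|Hv]; last first.
  rewrite pshift_none ?scaler0// => x; rewrite /shift_vertex.
  by have /asboolP-> := Hv; rewrite andbF.
apply: contrapT => nHv; case/eqP: c0.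
have : c * oapp (fun=> 1) 0 (shift_vertex H v (v, 0)) = 0 :=
  congr1 (fun g : endo _ => g (fun=> 1) (v, 0)) fv.
by rewrite /shift_vertex eqxx; have /asboolPn-> := nHv; rewrite /= mulr1.
Qed.

Lemma shift_kernel_basic (H : set (vertex E)) (f : L -> endo (vertex E * int -> R^o)) :
  nualg_hom f -> (forall v, f (lpa_vertex L v) = pshift R (shift_vertex H v)) ->
  basic_ideal [set x | f x = 0].
Proof.
move=> fhom fV; split=> [|c v c0 /=]; first exact: hom_kernel_ideal.
move=> /(shift_kernel_vertex fhom fV v c0) Hv.
rewrite -[lpa_vertex L v]scale1r; apply/(shift_kernel_vertex fhom fV) => //.
exact: oner_neq0.
Qed.

Lemma avoid_set0 v : ~~ `[< (set0 : set (vertex E)) v >].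
Proof. exact/asboolPn. Qed.

Lemma shift_vertex0 v (x : vertex E * int) :
  shift_vertex set0 v x = if x.1 == v then Some x else None.
Proof. by rewrite /shift_vertex avoid_set0; rewrite andbT. Qed.

Lemma hereditary_set0 : hereditary (set0 : set (vertex E)).
Proof. by []. Qed.

Lemma saturated_set0 : saturated (set0 : set (vertex E)).
Proof. by move=> v [[e ev] _] /(_ (rg e)); apply; exists e. Qed.

Lemma vertex_neq0 v : lpa_vertex L v <> 0.
Proof.
have [f [fhom fV _]] := shift_hom 0 hereditary_set0 saturated_set0.
move=> v0; apply/(shift_kernel_vertex fhom fV v (oner_neq0 R)).
by rewrite v0 scaler0; have [] := hom_kernel_ideal fhom.
Qed.

Lemma basically_simple_trivial :
  basically_simple L -> only_trivial_saturated_hereditary E.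
Proof.
move=> simple H hH sH; have [f [fhom fV _]] := shift_hom 0 hH sH.
have ker v : f (lpa_vertex L v) = 0 <-> H v.
  by rewrite -[lpa_vertex L v]scale1r; exact: shift_kernel_vertex (oner_neq0 R).
have [ker0|kerT] := simple _ (shift_kernel_basic fhom fV); [left|right].
  rewrite -subset0 => v /ker fv.
  have : [set x | f x = 0] (lpa_vertex L v) by [].
  by rewrite ker0 => /vertex_neq0.
rewrite -subTset => v _; apply/ker.
by have : [set x | f x = 0] (lpa_vertex L v) by rewrite kerT.
Qed.

(** An edge that is alone at its source has only the residue 0 modulo 1, so it
    translates the integer by [t]. *)
Lemma shift_path t (f : L -> endo (vertex E * int -> R^o)) u v p :
  nualg_hom f -> (forall v, f (lpa_vertex L v) = pshift R (shift_vertex set0 v)) ->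
  (forall e, f (lpa_edge L e) = pshift R (shift_edge set0 t e)) ->
  gpath u v p -> (forall e, e \in p -> outs set0 (src e) = [:: e]) ->
  f (path_elt L p v) =
  pshift R (fun x => if x.1 == u then Some (v, x.2 - t *+ size p) else None).
Proof.
move=> [_ _ fM] fV fB; elim: p u => [|e p IHp] u /=.
  move=> -> _; rewrite fV; apply: eq_pshift => -[w m]; rewrite shift_vertex0 /=.
  by case: eqP => // ->; rewrite mulr0n subr0.
move=> [<- pv] only; rewrite fM fB (IHp _ pv) => [|g gp]; last first.
  by apply: only; rewrite inE gp orbT.
rewrite pshiftM; apply: eq_pshift => -[w m]; rewrite /shift_edge /=.
have eo := only e (mem_head _ _).
have [->|we] := eqVneq w (src e).
  by rewrite eo mem_head /= eqxx modz1 divz1 /= eqxx mulrS opprD addrA.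
case: ifP => //; rewrite mem_outs// => /andP[/andP[/eqP ew _] _].
by rewrite ew eqxx in we.
Qed.

(** With [t = 0] an exitless closed path acts as its base, so the difference of
    the two lies in a basic ideal without vertices; with [t = 1] it acts as a
    proper shift, so the difference is not 0. *)
Lemma basically_simple_condition_L : basically_simple L -> condition_L E.
Proof.
move=> simple v p [p0 pv]; apply: contrapT => noexit.
have only e : e \in p -> outs set0 (src e) = [:: e].
  move=> ep; apply/perm_small_eq => //; apply: uniq_perm => //; first exact: outs_uniq.
  move=> g; rewrite mem_outs// avoid_set0 andbT inE; apply/eqP/eqP => [ge|->//].
  by apply: contrapT => nge; apply: noexit; exists g, e.
pose x := lpa_vertex L v - path_elt L p v.
have shift_diff (t : int) : exists f : L -> endo (vertex E * int -> R^o), [/\ nualg_hom f,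
    forall v, f (lpa_vertex L v) = pshift R (shift_vertex set0 v) &
    f x = pshift R (shift_vertex set0 v) -
      pshift R (fun x => if x.1 == v then Some (v, x.2 - t *+ size p) else None)].
  have [f [fhom fV fB]] := shift_hom t hereditary_set0 saturated_set0.
  exists f; split=> //; have [fD fZ _] := fhom.
  by rewrite /x -scaleN1r fD fZ scaleN1r fV (shift_path fhom fV fB pv only).
have [f [fhom fV fx]] := shift_diff 0.
have xker : [set y | f y = 0] x.
  rewrite /= fx; apply/eqP; rewrite subr_eq0; apply/eqP/eq_pshift => -[w m].
  by rewrite shift_vertex0 /= mul0rn subr0; case: eqP => // ->.
have [ker0|kerT] := simple _ (shift_kernel_basic fhom fV); last first.
  apply/(shift_kernel_vertex fhom fV v (oner_neq0 R)); rewrite scale1r.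
  by have : [set y | f y = 0] (lpa_vertex L v) by rewrite kerT.
rewrite ker0 /= in xker; have [g [ghom gV gx]] := shift_diff 1.
have [g0 _ _ _] := hom_kernel_ideal ghom; rewrite /= -xker gx in g0.
(* On the indicator function of the points [(_, 0)] the two operators differ at
   [(v, 0)], since a translation by [size p] moves 0. *)
pose delta (y : vertex E * int) : R := (y.2 == 0)%:R.
have : oapp delta 0 (shift_vertex set0 v (v, 0)) -
    oapp delta 0 (if v == v then Some (v, 0 - 1 *+ size p) else None) = 0 :=
  congr1 (fun h : endo (vertex E * int -> R^o) => h delta (v, 0)) g0.
rewrite shift_vertex0 /= eqxx /= /delta /= sub0r oppr_eq0.
rewrite natz eqz_nat size_eq0; case: eqP => // _ /eqP.
by rewrite subr0 oner_eq0.
Qed.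

End Kernels.

Theorem proposition7p22 (R : comNzRingType) (E : graph)
    (L : leavittPathAlgebra R E) (hE : row_finite E) :
  [<-> basically_simple L;
       condition_L E /\ only_trivial_saturated_hereditary E;
       condition_K E /\ only_trivial_saturated_hereditary E;
       [/\ condition_L E, cofinal E & sinks_reachable E];
       [/\ condition_K E, cofinal E & sinks_reachable E]].
Proof.
tfae.
- by move=> simple; split; [exact: basically_simple_condition_L simple
    | exact: basically_simple_trivial simple].
- by move=> [condL triv]; split=> //; apply: condition_L_K => //; exact: trivial_cofinal.
- move=> [/condition_K_L condL triv]; split=> //; first exact: trivial_cofinal.
  exact: trivial_sinks_reachable.
- by move=> [condL cof sinks]; split=> //; exact: condition_L_K.
move=> [/condition_K_L condL cof sinks]; apply: condition_L_basically_simple => //.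
exact: cofinal_trivial.
Qed.
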